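(* Let $K$ be a field of characteristic $0$, let $q$ be an indeterminate, and let $\mathcal{H}_n(q)$ be the Hecke algebra of $\mathfrak{S}_n$ over $K(q)$, with generators $T_1,\dots,T_{n-1}$ and relations $(T_i+1)(T_i-q)=0$, $T_iT_j=T_jT_i$ for $|i-j|\ge 2$, $T_iT_{i+1}T_i=T_{i+1}T_iT_{i+1}$. For $w\in\mathfrak{S}_n$ with a reduced decomposition $w=s_{a_1}\cdots s_{a_r}$ ($s_i=(i,i+1)$, $r$ the number of inversions of $w$), set $T_w=T_{a_1}\cdots T_{a_r}$; these form a basis. Let $E_i=\frac{1}{q+1}(q-1-2T_i)$ and define $c_w(q)\in K(q)$ by $$E_1E_2\cdots E_{n-1}\cdot E_1E_2\cdots E_{n-2}\cdots E_1E_2\cdot E_1=\sum_{w\in\mathfrak{S}_n}c_w(q)T_w.$$ For $w=a_1a_2\cdots a_n\in\mathfrak{S}_n$ (one-line notation) let $\widehat{w}=a_na_{n-1}\cdots a_1$ be its reversal, and let $\kappa(\widehat{w})$ be the number of cycles of $\widehat{w}$. Then $c_w(q)$ is divisible by $(q-1)^{n-\kappa(\widehat{w})}$, i.e. $c_w(q)=(q-1)^{n-\kappa(\widehat{w})}h(q)$ for some rational function $h(q)\in K(q)$ with no pole at $q=1$. *)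

(* Defs.v *)
From HB Require Import structures.
From mathcomp Require Import all_fingroup all_boot all_order all_algebra.
From mathcomp Require Import generic_quotient boolp.
From mathcomp Require Import monalg.

Set Implicit Arguments.
Unset Strict Implicit.
Unset Printing Implicit Defensive.

Import GRing.Theory.
Local Open Scope ring_scope.
Local Open Scope quotient_scope.

Section RationalFunctions.
Variable K : fieldType.

Definition ratfun := {fraction {poly K}}.
HB.instance Definition _ := GRing.Field.on ratfun.

Definition ratq : ratfun := tofrac 'X.

Definition regular_at (a : K) (h : ratfun) : Prop :=
  exists f g : {poly K}, g.[a] != 0 /\ h = tofrac f / tofrac g.

End RationalFunctions.

Section IdealQuotient.
Variables (F : fieldType) (A : algType F) (rel : A -> Prop).

(* The two-sided ideal generated by the elements satisfying rel. *)
Inductive ideal_gen : A -> Prop :=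
| Ideal_gen0 : ideal_gen 0
| Ideal_genD x y of ideal_gen x & ideal_gen y : ideal_gen (x + y)
| Ideal_genM a r b of rel r : ideal_gen (a * r * b).

Definition gideal : {pred A} := fun x => `[< ideal_gen x >].

Lemma gidealP x : reflect (ideal_gen x) (x \in gideal).
Proof. exact: asboolP. Qed.

Lemma gidealMl a x : x \in gideal -> a * x \in gideal.
Proof.
move=> /gidealP xI; apply/gidealP.
elim: xI => [|y z _ IHy _ IHz|b r c rel_r]; first by rewrite mulr0; constructor.
  by rewrite mulrDr; constructor.
by rewrite !mulrA; constructor.
Qed.

Lemma gidealMr x b : x \in gideal -> x * b \in gideal.
Proof.
move=> /gidealP xI; apply/gidealP.
elim: xI => [|y z _ IHy _ IHz|a r c rel_r]; first by rewrite mul0r; constructor.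
  by rewrite mulrDl; constructor.
by rewrite -mulrA; constructor.
Qed.

Lemma gideal_zmod_closed : zmod_closed gideal.
Proof.
split=> [|x y xI yI]; first by apply/gidealP; constructor.
apply/gidealP; constructor; apply/gidealP => //.
by rewrite -mulN1r gidealMl.
Qed.
HB.instance Definition _ := GRing.isZmodClosed.Build A gideal gideal_zmod_closed.

Lemma gidealZ a x : x \in gideal -> a *: x \in gideal.
Proof. by move=> xI; rewrite -[x]mul1r scalerAl gidealMl. Qed.

Lemma ideal_gen_ker (B : nzRingType) (f : {rmorphism A -> B}) :
  (forall r, rel r -> f r = 0) -> forall x, ideal_gen x -> f x = 0.
Proof.
move=> f0 x; elim=> [|y z _ fy _ fz|a r b /f0 fr]; first exact: rmorph0.
  by rewrite rmorphD fy fz addr0.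
by rewrite !rmorphM fr mulr0 mul0r.
Qed.

(* Algebras are nontrivial in the library, so the quotient carries a proof    *)
(* that the ideal is proper.                                                  *)
Variable proper : ~ ideal_gen 1.

Definition alg_quot of ~ ideal_gen 1 : Type := Quotient.quot gideal.
Local Notation Q := (alg_quot proper).

HB.instance Definition _ := GRing.Zmodule.on Q.
HB.instance Definition _ : EqQuotient A (Quotient.equiv gideal) Q :=
  EqQuotient.on Q.

Lemma alg_quot_eqP x y : reflect (\pi_Q x = \pi_Q y) (x - y \in gideal).
Proof. by rewrite Quotient.idealrBE; apply: eqP. Qed.

Lemma alg_quot_repr x : repr (\pi_Q x) - x \in gideal.
Proof. by apply/alg_quot_eqP; rewrite reprK. Qed.

Lemma alg_quot_piD : {morph \pi_Q : x y / x + y}.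
Proof. exact: Quotient.pi_add. Qed.

Definition alg_quot_mul := lift_op2 Q *%R.
Definition alg_quot_scale a := lift_op1 Q ( *:%R a).

Lemma alg_quot_piM : {morph \pi_Q : x y / x * y >-> alg_quot_mul x y}.
Proof.
move=> x y; unlock alg_quot_mul; apply/esym/alg_quot_eqP.
set x' := repr _; set y' := repr _.
have -> : x' * y' - x * y = (x' - x) * y' + x * (y' - y).
  by rewrite mulrBl mulrBr addrA subrK.
by apply: rpredD; [apply: gidealMr | apply: gidealMl]; apply: alg_quot_repr.
Qed.

Lemma alg_quot_piZ a : {morph \pi_Q : x / a *: x >-> alg_quot_scale a x}.
Proof.
move=> x; unlock alg_quot_scale; apply/esym/alg_quot_eqP.
by rewrite -scalerBr gidealZ ?alg_quot_repr.
Qed.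

Lemma alg_quot_mulA : associative alg_quot_mul.
Proof.
by elim/quotW=> x; elim/quotW=> y; elim/quotW=> z; rewrite -!alg_quot_piM mulrA.
Qed.

Lemma alg_quot_mul1r : left_id (\pi_Q 1) alg_quot_mul.
Proof. by elim/quotW=> x; rewrite -alg_quot_piM mul1r. Qed.

Lemma alg_quot_mulr1 : right_id (\pi_Q 1) alg_quot_mul.
Proof. by elim/quotW=> x; rewrite -alg_quot_piM mulr1. Qed.

Lemma alg_quot_mulDl : left_distributive alg_quot_mul +%R.
Proof.
elim/quotW=> x; elim/quotW=> y; elim/quotW=> z.
by rewrite -alg_quot_piD -!alg_quot_piM -alg_quot_piD mulrDl.
Qed.

Lemma alg_quot_mulDr : right_distributive alg_quot_mul +%R.
Proof.
elim/quotW=> x; elim/quotW=> y; elim/quotW=> z.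
by rewrite -alg_quot_piD -!alg_quot_piM -alg_quot_piD mulrDr.
Qed.

Lemma alg_quot_1neq0 : \pi_Q 1 != 0.
Proof.
have -> : 0 = \pi_Q 0.
  by apply: (addrI (\pi_Q 0)); rewrite addr0 -alg_quot_piD addr0.
by apply/eqP => /alg_quot_eqP; rewrite subr0 => /gidealP.
Qed.

HB.instance Definition _ := GRing.Zmodule_isNzRing.Build Q
  alg_quot_mulA alg_quot_mul1r alg_quot_mulr1 alg_quot_mulDl alg_quot_mulDr
  alg_quot_1neq0.

Lemma alg_quot_scaleA a b x :
  alg_quot_scale a (alg_quot_scale b x) = alg_quot_scale (a * b) x.
Proof. by elim/quotW: x => x; rewrite -!alg_quot_piZ scalerA. Qed.

Lemma alg_quot_scale1r : left_id 1 alg_quot_scale.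
Proof. by elim/quotW=> x; rewrite -alg_quot_piZ scale1r. Qed.

Lemma alg_quot_scaleDr : right_distributive alg_quot_scale +%R.
Proof.
move=> a; elim/quotW=> x; elim/quotW=> y.
by rewrite -alg_quot_piD -!alg_quot_piZ -alg_quot_piD scalerDr.
Qed.

Lemma alg_quot_scaleDl x : {morph alg_quot_scale^~ x : a b / a + b}.
Proof.
by elim/quotW: x => x a b; rewrite -!alg_quot_piZ -alg_quot_piD scalerDl.
Qed.

HB.instance Definition _ := GRing.Zmodule_isLmodule.Build F Q
  alg_quot_scaleA alg_quot_scale1r alg_quot_scaleDr alg_quot_scaleDl.

Lemma alg_quot_scaleAl a x y :
  alg_quot_scale a (alg_quot_mul x y) = alg_quot_mul (alg_quot_scale a x) y.
Proof.
elim/quotW: x => x; elim/quotW: y => y.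
by rewrite -alg_quot_piM -!alg_quot_piZ -alg_quot_piM scalerAl.
Qed.

Lemma alg_quot_scaleAr a x y :
  alg_quot_scale a (alg_quot_mul x y) = alg_quot_mul x (alg_quot_scale a y).
Proof.
elim/quotW: x => x; elim/quotW: y => y.
by rewrite -alg_quot_piM -!alg_quot_piZ -alg_quot_piM scalerAr.
Qed.

HB.instance Definition _ := GRing.Lmodule_isLalgebra.Build F Q alg_quot_scaleAl.
HB.instance Definition _ := GRing.Lalgebra_isAlgebra.Build F Q alg_quot_scaleAr.

End IdealQuotient.

(* Generators are indexed from 0: i : 'I_n.-1 stands for the index i + 1 of   *)
(* the usual numbering 1, ..., n - 1.                                         *)
Inductive hecke_relator (F : fieldType) (q : F) (n : nat) (A : algType F)
    (t : 'I_n.-1 -> A) : A -> Prop :=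
| Hecke_quadratic i : hecke_relator q t ((t i + 1) * (t i - q%:A))
| Hecke_commutation (i j : 'I_n.-1) of (i.+2 <= j)%N || (j.+2 <= i)%N :
    hecke_relator q t (t i * t j - t j * t i)
| Hecke_braid (i j : 'I_n.-1) of j = i.+1 :> nat :
    hecke_relator q t (t i * t j * t i - t j * t i * t j).

Lemma hecke_relator_char (F : fieldType) (q : F) n (A : algType F)
    (t : 'I_n.-1 -> A) (f : {rmorphism A -> F}) :
  (forall i, f (t i) = q) -> f q%:A = q ->
  forall r, hecke_relator q t r -> f r = 0.
Proof.
move=> ft fq r [i|i j _|i j _]; rewrite ?rmorphM rmorphB /= ?rmorphM ?ft ?fq.
- by rewrite subrr mulr0.
- by rewrite subrr.
- by rewrite subrr.
Qed.

Section HeckeAlgebra.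
Variables (F : fieldType) (q : F) (n : nat).

Definition hecke_free := {malg F[{fmonom 'I_n.-1}]}.
HB.instance Definition _ := GRing.Lalgebra.on hecke_free.

Lemma hecke_free_scalerAr a (x y : hecke_free) : a *: (x * y) = x * (a *: y).
Proof.
have cC (z : hecke_free) : malgC a * z = z * malgC a.
  rewrite !malgM_def fgmulUg fgmulgU; apply: eq_bigr => k _.
  by rewrite mulrC mul1m mulm1.
by rewrite -!mul_malgC !mulrA cC.
Qed.
HB.instance Definition _ :=
  GRing.Lalgebra_isAlgebra.Build F hecke_free hecke_free_scalerAr.

Definition free_gen (i : 'I_n.-1) : hecke_free := mkmalgU (fmu i) 1.

(* The one-dimensional representation T_i |-> q shows that the relations do   *)
(* not collapse the free algebra.                                             *)
Definition free_char (m : {fmonom 'I_n.-1}) : F := q ^+ size m.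

Lemma free_char_mmorphism : mmorphism free_char.
Proof. by split=> [x y|]; rewrite /free_char ?fm1 // -exprD fmM size_cat. Qed.
HB.instance Definition _ := isMultiplicative.Build
  {fmonom 'I_n.-1} F free_char free_char_mmorphism.

Lemma hecke_proper : ~ ideal_gen (hecke_relator q free_gen) 1.
Proof.
pose f : {rmorphism hecke_free -> F} := mmap idfun free_char.
have ft i : f (free_gen i) = q.
  by rewrite /f /= mmapU /= mul1r /free_char fmU expr1.
have fq : f q%:A = q by rewrite /f /= mmapZ mmap1 mulr1.
move=> /(ideal_gen_ker (hecke_relator_char ft fq)) /eqP.
by rewrite rmorph1 oner_eq0.
Qed.

Definition hecke : Type := alg_quot hecke_proper.
HB.instance Definition _ := GRing.Algebra.on hecke.

Definition hecke_T (i : 'I_n.-1) : hecke :=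
  \pi_(alg_quot hecke_proper) (free_gen i).

Definition hecke_E (i : 'I_n.-1) : hecke :=
  (q + 1)^-1 *: ((q - 1)%:A - hecke_T i *+ 2).

(* The k-th factor, k = 0, ..., n - 2, is E_1 E_2 ... E_(n-1-k). *)
Definition hecke_Eprod : hecke :=
  \prod_(k < n.-1) \prod_(i < n.-1 | (i < n.-1 - k)%N) hecke_E i.

End HeckeAlgebra.

Section Permutations.
Variable n : nat.

Lemma adj_lt (i : 'I_n.-1) : (i < n)%N.
Proof. by apply: leq_trans (ltn_ord i) (leq_pred n). Qed.

Lemma adj_ltS (i : 'I_n.-1) : (i.+1 < n)%N.
Proof. by rewrite -ltn_predRL. Qed.

Definition adj (i : 'I_n.-1) : 'S_n :=
  tperm (Ordinal (adj_lt i)) (Ordinal (adj_ltS i)).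

Definition inversions (w : 'S_n) : {set 'I_n * 'I_n} :=
  [set p : 'I_n * 'I_n | (p.1 < p.2)%N && (w p.2 < w p.1)%N].

(* Permutations are composed as functions, from right to left, whereas the    *)
(* product of 'S_n satisfies (s * t) x = t (s x); hence the reversal.         *)
Definition reduced_word (w : 'S_n) (a : seq 'I_n.-1) : bool :=
  (w == (\prod_(i <- rev a) adj i)%g) && (size a == #|inversions w|).

Definition reversal (w : 'S_n) : 'S_n :=
  perm (inj_comp (@perm_inj _ w) (@rev_ord_inj n)).

Definition ncycles (w : 'S_n) : nat := #|porbits w|.

End Permutations.

(* Main.v *)
(* Write [e = q - 1]. Right multiplication by [E_i] sends [T_w] to a          *)
(* combination of [T_(w s_i)] and [T_w] with coefficients regular at [q = 1], *)
(* the second one being divisible by [e]. Hence [c_w] is divisible by [e ^ k] *)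
(* whenever at least [k] letters have to be deleted from the word             *)
(* [s_1 ... s_(n-1) s_1 ... s_(n-2) ... s_1] of the longest element [w_0] to  *)
(* obtain a word of [w]. Deleting a letter multiplies by a transposition,     *)
(* which changes the number of cycles by one, so [n - kappa (w w_0)] deletions*)
(* are needed, and [w w_0] is the reversal of [w]. Coefficients can be        *)
(* compared because the [T_w] are linearly independent: in the regular        *)
(* representation, built on functions ['S_n -> F], a reduced word of [w] maps *)
(* the basis vector of [1] to that of [w].                                    *)

Require Import Defs.
From HB Require Import structures.
From mathcomp Require Import all_fingroup all_boot all_order all_algebra.
From mathcomp Require Import finmap generic_quotient monalg ring zify.

Set Implicit Arguments.
Unset Strict Implicit.
Unset Printing Implicit Defensive.

Import GRing.Theory.
Local Open Scope ring_scope.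
Local Open Scope quotient_scope.

(** The product of the [E_i] is followed, factor by factor, in the right regular representation,
    starting from the basis vector of 1. The invariant [vanishes_along] bounds from below, for each
    [w], the order of vanishing at [q = 1] of the coefficient at [w] by the number of transpositions
    separating [w] from the element spelled so far. [vanishes_along_E] carries it through one
    factor: the term moved by [s_i] has exactly the required order, while the term left at [w] gains
    a factor [q - 1], which pays for the change of the cycle count by at most one
    ([ncycles_insert_adj]). At the end [adj_prod_mul] brings in the reversal, and
    [reg_act_expansion] recovers the coefficients [c] from the action on the basis vector of 1. *)

Section FreeAction.
Variables (F : fieldType) (n : nat) (V : lmodType F).
Variable op : 'I_n.-1 -> {linear V -> V}.

(** * Right action of the Hecke algebra through operators satisfying its relations *)

Definition word_act (s : seq 'I_n.-1) (v : V) : V :=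
  foldl (fun u i => op i u) v s.

Lemma word_act_is_linear s : linear (word_act s).
Proof.
move=> a u v; elim/last_ind: s => [//|s i IHs].
by rewrite /word_act !foldl_rcons -![foldl _ _ _]/(word_act _ _) IHs linearP.
Qed.
HB.instance Definition _ s :=
  GRing.isLinear.Build F V V _ (word_act s) (word_act_is_linear s).

(** Evaluation of a noncommutative polynomial at the operators [op]; the leftmost letter of a
    monomial acts first, which makes this a right action. *)
Definition free_act (x : hecke_free F n) (v : V) : V :=
  \sum_(m <- msupp x) x@_m *: word_act m v.

(** Enlarging the index set beyond the support allows elements with different supports to be
    compared term by term. *)
Lemma free_actEw (d : {fset {fmonom 'I_n.-1}}) (x : hecke_free F n) v :
  (msupp x `<=` d)%fset ->
  free_act x v = \sum_(m <- d) x@_m *: word_act m v.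
Proof.
move=> le_xd; apply: big_fset_incl => // m _ /mcoeff_outdom ->.
by rewrite scale0r.
Qed.

Lemma free_actU c m v :
  free_act << c *g m >> v = c *: word_act m v.
Proof. by rewrite (free_actEw _ msuppU_le) big_seq_fset1 mcoeffUU. Qed.

Lemma free_act_gen i v : free_act (free_gen F i) v = op i v.
Proof. by rewrite free_actU fmU scale1r. Qed.

Lemma free_act1 v : free_act 1 v = v.
Proof. by rewrite free_actU fm1 scale1r. Qed.

Lemma free_actD x y v : free_act (x + y) v = free_act x v + free_act y v.
Proof.
pose d := (msupp x `|` msupp y)%fset.
rewrite (free_actEw (d := d)) ?msuppD_le // (free_actEw (d := d)) ?fsubsetUl //.
rewrite (free_actEw (x := y) (d := d)) ?fsubsetUr // -big_split /=.
by apply: eq_bigr => m _; rewrite mcoeffD scalerDl.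
Qed.

Lemma free_act0 v : free_act 0 v = 0.
Proof. by apply: (addrI (free_act 0 v)); rewrite -free_actD !addr0. Qed.

Lemma free_actZ a x v : free_act (a *: x) v = a *: free_act x v.
Proof.
rewrite (free_actEw _ (msuppZ_le _ _)) scaler_sumr.
by apply: eq_bigr => m _; rewrite mcoeffZ scalerA.
Qed.

Lemma free_actN x v : free_act (- x) v = - free_act x v.
Proof. by apply/eqP; rewrite -addr_eq0 -free_actD addNr free_act0. Qed.

Lemma free_act_sum (I : Type) (r : seq I) (x : I -> hecke_free F n) v :
  free_act (\sum_(k <- r) x k) v = \sum_(k <- r) free_act (x k) v.
Proof.
by elim/big_rec2: _ => [|k y z _ <-]; rewrite ?free_act0 // free_actD.
Qed.

Lemma free_actM x y v : free_act (x * y) v = free_act y (free_act x v).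
Proof.
rewrite malgME free_act_sum.
under eq_bigr do rewrite free_act_sum.
rewrite exchange_big /=; apply: eq_bigr => m _.
rewrite linear_sum scaler_sumr /=; apply: eq_bigr => k _.
rewrite free_actU fmM /word_act foldl_cat -!/(word_act _ _).
by rewrite linearZ scalerA mulrC.
Qed.

Lemma free_act0r x : free_act x 0 = 0.
Proof. by apply: big1 => m _; rewrite linear0 scaler0. Qed.

Section HeckeAction.
Variable q : F.
Hypothesis op_quadratic :
  forall i v, op i (op i v) = (q - 1) *: op i v + q *: v.
Hypothesis op_commutation : forall (i j : 'I_n.-1) v,
  (i.+2 <= j)%N || (j.+2 <= i)%N -> op i (op j v) = op j (op i v).
Hypothesis op_braid : forall (i j : 'I_n.-1) v,
  j = i.+1 :> nat -> op i (op j (op i v)) = op j (op i (op j v)).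

Lemma free_act_relator r v :
  hecke_relator q (@free_gen F n) r -> free_act r v = 0.
Proof.
case=> [i|i j ij|i j ij]; rewrite !(free_actM, free_actD, free_actN).
- rewrite free_actZ free_act1 !free_act_gen free_act1 linearD op_quadratic.
  rewrite scalerDr scalerBl scale1r; apply/eqP.
  by rewrite subr_eq0 -addrA [q *: v + _]addrC addrA subrK.
- by rewrite !free_act_gen (op_commutation _ ij) subrr.
- by rewrite !free_act_gen (op_braid _ ij) subrr.
Qed.

Lemma free_act_ideal x v :
  x \in gideal (hecke_relator q (@free_gen F n)) -> free_act x v = 0.
Proof.
move=> /gidealP xI; elim: xI v => [|y z _ IHy _ IHz|a r b rel_r] v.
- exact: free_act0.
- by rewrite free_actD IHy IHz addr0.
- by rewrite !free_actM (free_act_relator _ rel_r) free_act0r.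
Qed.

Local Notation H := (alg_quot (@hecke_proper F q n)).

(** The choice of representative is immaterial because the ideal of relations acts by zero; see
    [hecke_act_pi]. *)
Definition hecke_act (x : hecke q n) (v : V) : V := free_act (repr (x : H)) v.

Lemma hecke_act_pi x v : hecke_act (\pi_H x) v = free_act x v.
Proof.
apply/eqP; rewrite -subr_eq0 -free_actN -free_actD free_act_ideal //.
exact: alg_quot_repr.
Qed.

Lemma hecke_act_T i v : hecke_act (hecke_T q i) v = op i v.
Proof. by rewrite hecke_act_pi free_act_gen. Qed.

Lemma hecke_act1 v : hecke_act 1 v = v.
Proof. by rewrite hecke_act_pi free_act1. Qed.

Lemma hecke_actD x y v : hecke_act (x + y) v = hecke_act x v + hecke_act y v.
Proof.
rewrite -[x](@reprK _ H) -[y](@reprK _ H).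
by rewrite -alg_quot_piD !hecke_act_pi free_actD.
Qed.

Lemma hecke_act0 v : hecke_act 0 v = 0.
Proof. by apply: (addrI (hecke_act 0 v)); rewrite -hecke_actD !addr0. Qed.

Lemma hecke_actN x v : hecke_act (- x) v = - hecke_act x v.
Proof. by apply/eqP; rewrite -addr_eq0 -hecke_actD addNr hecke_act0. Qed.

Lemma hecke_actZ a x v : hecke_act (a *: x) v = a *: hecke_act x v.
Proof.
rewrite -[x](@reprK _ H).
rewrite -[LHS]/(hecke_act (alg_quot_scale a _) v) -alg_quot_piZ.
by rewrite !hecke_act_pi free_actZ.
Qed.

Lemma hecke_actM x y v : hecke_act (x * y) v = hecke_act y (hecke_act x v).
Proof.
rewrite -[x](@reprK _ H) -[y](@reprK _ H).
rewrite -[LHS]/(hecke_act (alg_quot_mul _ _) v) -alg_quot_piM.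
by rewrite !hecke_act_pi free_actM.
Qed.

Lemma hecke_act_sum (I : Type) (r : seq I) (x : I -> hecke q n) v :
  hecke_act (\sum_(k <- r) x k) v = \sum_(k <- r) hecke_act (x k) v.
Proof.
by elim/big_rec2: _ => [|k y z _ <-]; rewrite ?hecke_act0 // hecke_actD.
Qed.

Lemma hecke_act_word s v :
  hecke_act (\prod_(i <- s) hecke_T q i) v = word_act s v.
Proof.
elim: s v => [|i s IHs] v; first by rewrite big_nil hecke_act1.
by rewrite big_cons hecke_actM hecke_act_T IHs.
Qed.

Lemma hecke_act_E i v :
  hecke_act (hecke_E q i) v =
  (q + 1)^-1 *: ((q - 1) *: v - op i v *+ 2).
Proof.
rewrite hecke_actZ hecke_actD hecke_actZ hecke_act1 hecke_actN.
by rewrite !mulr2n hecke_actD hecke_act_T.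
Qed.

End HeckeAction.
End FreeAction.

(** * Adjacent transpositions and descents *)

Section AdjacentTranspositions.
Variable n : nat.
Implicit Types (i j : 'I_n.-1) (w : 'S_n).
Local Open Scope group_scope.

(** Under the composition of ['S_n], [adj i * w] is the function [w] after [s_i], that is, [w]
    multiplied on the right by [s_i] in the usual notation; a descent is the case where this
    shortens [w]. *)
Definition descent i w : bool :=
  (w (Ordinal (adj_ltS i)) < w (Ordinal (adj_lt i)))%N.

Lemma adjK i w : adj i * (adj i * w) = w.
Proof. by rewrite mulgA tperm2 mul1g. Qed.

Lemma adjE i (x : 'I_n) : adj i x =
  (if x == i :> nat then i.+1
   else if x == i.+1 :> nat then (i : nat) else x) :> nat.
Proof.
rewrite permE /= -!val_eqE /=.
by case: eqP => [//|_]; case: eqP.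
Qed.

Lemma adjC i j :
  (i.+2 <= j)%N || (j.+2 <= i)%N -> adj i * adj j = adj j * adj i.
Proof.
move=> ij; apply/perm.permP => x; apply: val_inj; rewrite /= !permM !adjE.
by repeat case: eqP => //; lia.
Qed.

Lemma adj_braid i j : j = i.+1 :> nat ->
  adj i * (adj j * adj i) = adj j * (adj i * adj j).
Proof.
move=> ij; apply/perm.permP => x; apply: val_inj; rewrite /= !permM !adjE ij.
by repeat case: eqP => //; lia.
Qed.

Lemma perm_ord_neq w (x y : 'I_n) : x != y :> nat -> w x != w y :> nat.
Proof. by apply: contra => /eqP /val_inj /perm_inj ->. Qed.

Lemma descentE w i (x y : 'I_n) : x = i :> nat -> y = i.+1 :> nat ->
  descent i w = (w y < w x)%N.
Proof. by move=> xi yi; congr (w _ < w _)%N; apply: val_inj. Qed.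

Lemma descent_mul i (v : 'S_n) w (x y : 'I_n) :
  v (Ordinal (adj_lt i)) = x :> nat -> v (Ordinal (adj_ltS i)) = y :> nat ->
  descent i (v * w) = (w y < w x)%N.
Proof. by move=> /val_inj vx /val_inj vy; rewrite /descent !permM vx vy. Qed.

Lemma descent_adj i w : descent i (adj i * w) = ~~ descent i w.
Proof.
rewrite /descent !permM tpermL tpermR -leqNgt ltn_neqAle.
by rewrite perm_ord_neq //=; lia.
Qed.

Lemma descent_adjC i j w : (i.+2 <= j)%N || (j.+2 <= i)%N ->
  descent i (adj j * w) = descent i w.
Proof.
move=> ij; apply: descent_mul; rewrite adjE;
  by repeat case: eqP => //=; lia.
Qed.

End AdjacentTranspositions.

(** * The right regular representation on coefficient functions *)

Section RegularRepresentation.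
Variables (F : fieldType) (q : F) (n : nat).
Local Notation V := {ffun 'S_n -> F^o}.

(* The element [\sum_w f w *: T_w] multiplied on the right by [T_i]. *)
Definition reg_fun (i : 'I_n.-1) (f : V) : V :=
  [ffun w => if descent i w then f (adj i * w)%g + (q - 1) * f w
             else q * f (adj i * w)%g].

Lemma reg_fun_is_linear i : linear (reg_fun i).
Proof.
move=> a f g; apply/ffunP => w; rewrite !ffunE /GRing.scale /=.
by case: ifP => _; ring.
Qed.
HB.instance Definition _ i :=
  GRing.isLinear.Build F V V _ (reg_fun i) (reg_fun_is_linear i).

Definition reg_op i : {linear V -> V} := reg_fun i.

Lemma reg_op_quadratic i f :
  reg_op i (reg_op i f) = (q - 1) *: reg_op i f + q *: f.
Proof.
apply/ffunP => w; rewrite !ffunE /GRing.scale /= descent_adj adjK.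
by case: (descent i w) => /=; ring.
Qed.

Lemma reg_op_commutation (i j : 'I_n.-1) f : (i.+2 <= j)%N || (j.+2 <= i)%N ->
  reg_op i (reg_op j f) = reg_op j (reg_op i f).
Proof.
move=> ij; have ji : (j.+2 <= i)%N || (i.+2 <= j)%N by rewrite orbC.
apply/ffunP => w; rewrite !ffunE /= descent_adjC // descent_adjC //.
rewrite !mulgA (adjC ij).
by case: (descent i w); case: (descent j w); ring.
Qed.

(** Every descent test met along the two sides compares two of the values of [w] at [i], [i+1],
    [i+2], so a polynomial identity remains for each relative order of these three values. *)
Lemma reg_op_braid (i j : 'I_n.-1) f : j = i.+1 :> nat ->
  reg_op i (reg_op j (reg_op i f)) = reg_op j (reg_op i (reg_op j f)).
Proof.
move=> ij; apply/ffunP => w.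
pose a := Ordinal (adj_lt i); pose b := Ordinal (adj_ltS i).
pose c := Ordinal (adj_ltS j).
have diw : descent i w = (w b < w a)%N by [].
have djw : descent j w = (w c < w b)%N by apply: descentE.
have dji : descent j (adj i * w)%g = (w c < w a)%N.
  by apply: descent_mul; rewrite adjE /= ij; repeat case: eqP => //=; lia.
have dij : descent i (adj j * w)%g = (w c < w a)%N.
  by apply: descent_mul; rewrite adjE /= ij; repeat case: eqP => //=; lia.
have diji : descent i (adj j * (adj i * w))%g = (w c < w b)%N.
  rewrite mulgA; apply: descent_mul; rewrite permM !adjE /= ij;
  by repeat case: eqP => //=; lia.
have djij : descent j (adj i * (adj j * w))%g = (w b < w a)%N.
  rewrite mulgA; apply: descent_mul; rewrite permM !adjE /= ij;
  by repeat case: eqP => //=; lia.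
have bw : (adj i * (adj j * (adj i * w)) = adj j * (adj i * (adj j * w)))%g.
  by have:= congr1 (mulg^~ w) (adj_braid ij); rewrite -!mulgA.
rewrite !ffunE /= !descent_adj !adjK dji dij diji djij diw djw bw.
have ab : w a != w b :> nat by apply: perm_ord_neq => /=; lia.
have bc : w b != w c :> nat by apply: perm_ord_neq => /=; lia.
have ac : w a != w c :> nat by apply: perm_ord_neq => /=; lia.
(* Of the eight outcomes of the three comparisons, six are genuine orders and the other two are
   cyclic, hence impossible. *)
case: (ltngtP (w a) (w b)) ab => //= ab _;
  case: (ltngtP (w b) (w c)) bc => //= bc _;
  case: (ltngtP (w a) (w c)) ac => //= ac _; try ring; exfalso; lia.
Qed.

End RegularRepresentation.

(** * Inversions and word length *)

Section Inversions.
Variable n : nat.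
Implicit Types (i : 'I_n.-1) (w : 'S_n) (a : seq 'I_n.-1).
Local Open Scope group_scope.

(** Exchanging the positions [i] and [i+1] keeps the order of every increasing pair of positions
    except [(lo, hi)], and that pair becomes the one new inversion. *)
Lemma card_inversions_adj i w :
  ~~ descent i w -> #|inversions (adj i * w)| = #|inversions w|.+1.
Proof.
move=> asc; pose lo := Ordinal (adj_lt i); pose hi := Ordinal (adj_ltS i).
have lo_hi : (lo < hi)%N := ltnSn i.
have asc' : (w hi < w lo)%N = false := negbTE asc.
pose phi (p : 'I_n * 'I_n) := (adj i p.1, adj i p.2).
have phiK : involutive phi by case=> x y; rewrite /phi /= !tpermK.
have adj_mono (x y : 'I_n) :
    (x < y)%N -> (x, y) != (lo, hi) -> (adj i x < adj i y)%N.
  rewrite xpair_eqE -!val_eqE /= !adjE => xy ne.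
  by repeat case: eqP; lia.
have -> : inversions (adj i * w) = (lo, hi) |: phi @: inversions w.
  apply/setP => -[x y]; rewrite (can_imset_pre _ phiK) !inE /= !permM.
  have [[-> ->]|ne] /= := eqVneq.
    rewrite lo_hi tpermL tpermR ltn_neqAle leqNgt asc' andbT.
    by rewrite perm_ord_neq // neq_ltn lo_hi.
  have [[sx sy]|ne'] := eqVneq (adj i x, adj i y) (lo, hi).
    by rewrite sx sy asc' !andbF.
  congr (_ && _); apply/idP/idP => [xy|/adj_mono]; first exact: adj_mono.
  by rewrite !tpermK; apply.
rewrite cardsU1 (card_imset _ (inv_inj phiK)) (can_imset_pre _ phiK) !inE /=.
by rewrite tpermL tpermR ltnNge (ltnW lo_hi).
Qed.

Lemma inversions1 : #|inversions (1 : 'S_n)| = 0%N.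
Proof.
apply/eqP; rewrite cards_eq0; apply/eqP/setP => p.
by rewrite !inE !perm1; case: ltngtP.
Qed.

Lemma card_inversions_adj_le i w :
  (#|inversions (adj i * w)| <= #|inversions w|.+1)%N.
Proof.
have [desc|/card_inversions_adj ->//] := boolP (descent i w).
have := @card_inversions_adj i (adj i * w).
by rewrite descent_adj desc adjK => /(_ isT); lia.
Qed.

Definition word_perm a : 'S_n := \prod_(i <- rev a) adj i.

Lemma word_perm_rcons a i : word_perm (rcons a i) = adj i * word_perm a.
Proof. by rewrite /word_perm rev_rcons big_cons. Qed.

Lemma card_inversions_word a : (#|inversions (word_perm a)| <= size a)%N.
Proof.
elim/last_ind: a => [|a i IHa]; first by rewrite /word_perm big_nil inversions1.
rewrite word_perm_rcons size_rcons.
exact: leq_trans (card_inversions_adj_le _ _) _.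
Qed.

End Inversions.

(** * Reduced words acting on the basis vector of 1 *)

Section ReducedWords.
Variables (F : fieldType) (q : F) (n : nat).

Definition delta_perm (v : 'S_n) : {ffun 'S_n -> F^o} :=
  [ffun w => (w == v)%:R].

Lemma reg_op_basis i w :
  ~~ descent i w -> reg_op q i (delta_perm w) = delta_perm (adj i * w)%g.
Proof.
move=> asc; apply/ffunP => v; rewrite !ffunE.
have -> : ((adj i * v)%g == w) = (v == (adj i * w)%g).
  by apply/eqP/eqP => [<-|->]; rewrite adjK.
have [->|ne] := eqVneq v (adj i * w)%g.
  rewrite descent_adj asc; have [e|_] := eqVneq (adj i * w)%g w.
    by move: asc (descent_adj i w); rewrite e; case: descent.
  by rewrite mulr0 addr0.
by case: eqVneq => [->|_]; rewrite ?(negPf asc) ?mulr0 ?addr0 ?if_same.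
Qed.

(** A letter adds at most one inversion, so in a reduced word every letter adds exactly one:
    prefixes are reduced and each step is an ascent, where [T_i] sends a basis vector to a basis
    vector. *)
Lemma word_act_reduced a : size a = #|inversions (word_perm a)| ->
  word_act (@reg_op _ q n) a (delta_perm 1%g) = delta_perm (word_perm a).
Proof.
elim/last_ind: a => [|a i IHa]; first by rewrite /word_perm big_nil.
rewrite word_perm_rcons size_rcons => red.
rewrite /word_act foldl_rcons -/(word_act _ _ _).
have le_a := card_inversions_word a.
have le_ai := card_inversions_adj_le i (word_perm a).
rewrite IHa ?reg_op_basis //; last by lia.
apply/negP => desc; have:= @card_inversions_adj _ i (adj i * word_perm a)%g.
rewrite descent_adj desc adjK => /(_ isT); lia.
Qed.

Definition reg_act (x : hecke q n) (f : {ffun 'S_n -> F^o}) :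
  {ffun 'S_n -> F^o} := hecke_act (@reg_op F q n) x f.

Let quad := @reg_op_quadratic F q n.
Let comm := @reg_op_commutation F q n.
Let braid := @reg_op_braid F q n.

Lemma reg_act1 f : reg_act 1 f = f.
Proof. exact: hecke_act1 quad comm braid f. Qed.

Lemma reg_actM x y f : reg_act (x * y) f = reg_act y (reg_act x f).
Proof. exact: hecke_actM quad comm braid x y f. Qed.

Lemma reg_act_E i f w : reg_act (hecke_E q i) f w =
  (q + 1)^-1 * (if descent i w then - 2 * f (adj i * w)%g - (q - 1) * f w
                else - 2 * q * f (adj i * w)%g + (q - 1) * f w).
Proof.
rewrite /reg_act (hecke_act_E quad comm braid) !ffunE /GRing.scale /=.
by case: ifP => _; congr (_ * _); ring.
Qed.

(** This is the linear independence of the [T_w]: their images of the basis vector of 1 are distinct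
    basis vectors, so the coefficients can be read off. *)
Lemma reg_act_expansion (red : 'S_n -> seq 'I_n.-1) (c : 'S_n -> F) :
  (forall w, reduced_word w (red w)) -> forall w,
  reg_act (\sum_w c w *: \prod_(i <- red w) hecke_T q i) (delta_perm 1%g) w
  = c w.
Proof.
move=> red_ok w; rewrite /reg_act (hecke_act_sum quad comm braid) sum_ffunE.
have actE v : hecke_act (@reg_op F q n)
    (c v *: \prod_(i <- red v) hecke_T q i) (delta_perm 1%g) w
    = c v * (w == v)%:R.
  rewrite (hecke_actZ quad comm braid) (hecke_act_word quad comm braid).
  have /andP[/eqP v_def /eqP sz] := red_ok v.
  by rewrite word_act_reduced /word_perm -v_def // !ffunE.
rewrite (bigD1 w) //= actE eqxx mulr1 big1 ?addr0 // => v wv.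
by rewrite actE eq_sym (negPf wv) mulr0.
Qed.

(** Runs in parallel through the product of the [E_i] and the product of the [adj i] taken in the
    same order. *)
Lemma hecke_Eprod_ind (P : 'S_n -> hecke q n -> Prop) :
  P 1%g 1 ->
  (forall u v x y, P u x -> P v y -> P (u * v)%g (x * y)) ->
  (forall i, P (adj i) (hecke_E q i)) ->
  P (\prod_(k < n.-1) \prod_(i < n.-1 | (i < n.-1 - k)%N) adj i)%g
    (hecke_Eprod q n).
Proof.
move=> P1 PM PE; apply: (big_ind2 (R1 := 'S_n) P) => // [u x v y|k _].
  exact: PM.
by apply: (big_ind2 (R1 := 'S_n) P) => // u x v y; apply: PM.
Qed.

End ReducedWords.

(** * Regularity and order of vanishing of rational functions *)

Section RegularAt.
Variables (K : fieldType) (a : K).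
Implicit Types x y : ratfun K.

Lemma regular_tofrac (f : {poly K}) : regular_at a (tofrac f : ratfun K).
Proof. by exists f, 1; rewrite hornerC oner_neq0 tofrac1 divr1. Qed.

Lemma regular_tofracV (g : {poly K}) :
  g.[a] != 0 -> regular_at a ((tofrac g)^-1 : ratfun K).
Proof. by move=> ga; exists 1, g; rewrite tofrac1 mul1r. Qed.

Lemma regularD x y :
  regular_at a x -> regular_at a y -> regular_at a (x + y).
Proof.
move=> [f [g [ga ->]]] [f' [g' [ga' ->]]].
have nz (p : {poly K}) : p.[a] != 0 -> tofrac p != 0.
  by rewrite tofrac_eq0; apply: contraNneq => ->; rewrite horner0.
exists (f * g' + f' * g), (g * g'); rewrite hornerM mulf_neq0 //; split=> //.
by rewrite tofracD !tofracM addf_div ?nz.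
Qed.

Lemma regularM x y :
  regular_at a x -> regular_at a y -> regular_at a (x * y).
Proof.
move=> [f [g [ga ->]]] [f' [g' [ga' ->]]].
exists (f * f'), (g * g'); rewrite hornerM mulf_neq0 //; split=> //.
by rewrite !tofracM mulf_div.
Qed.

End RegularAt.

Section Vanishing.
Variable K : fieldType.
Implicit Types (x y : ratfun K) (k : nat).
Local Notation q := (ratq K).

Definition vanishes k x : Prop :=
  exists h : ratfun K, regular_at 1 h /\ x = (q - 1) ^+ k * h.

Lemma regular_q : regular_at 1 q.
Proof. exact: regular_tofrac. Qed.

Lemma regular_int (m : int) : regular_at 1 (m%:~R : ratfun K).
Proof. by rewrite -(rmorph_int (@tofrac _)); apply: regular_tofrac. Qed.

Lemma vanishesD k x y : vanishes k x -> vanishes k y -> vanishes k (x + y).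
Proof.
move=> [h [rh ->]] [h' [rh' ->]]; exists (h + h').
by split; [apply: regularD | rewrite mulrDr].
Qed.

Lemma vanishesM k x y : regular_at 1 x -> vanishes k y -> vanishes k (x * y).
Proof.
move=> rx [h [rh ->]]; exists (x * h).
by split; [apply: regularM | rewrite mulrCA].
Qed.

Lemma vanishesS k x : vanishes k x -> vanishes k.+1 ((q - 1) * x).
Proof. by move=> [h [rh ->]]; exists h; rewrite exprS mulrA. Qed.

Lemma vanishesW k l x : (k <= l)%N -> vanishes l x -> vanishes k x.
Proof.
move=> kl [h [rh ->]]; exists ((q - 1) ^+ (l - k) * h).
split; last by rewrite mulrA -exprD subnKC.
rewrite /ratq -(tofrac1 {poly K}) -tofracB -tofracXn.
exact: regularM (regular_tofrac _ _) rh.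
Qed.

Lemma vanishes0 k : vanishes k 0.
Proof. by exists 0; rewrite mulr0; split=> //; exact: (regular_int 0). Qed.

End Vanishing.

(** * Effect of a transposition on the number of cycles *)

Section Cycles.
Variable n : nat.
Implicit Types u v w : 'S_n.
Local Open Scope group_scope.

Lemma ncycles1 : ncycles (1 : 'S_n) = n.
Proof.
rewrite /ncycles card_imset ?card_ord // => x y eq_xy.
have /porbitP[k ->] : x \in porbit 1 y by rewrite -eq_xy porbit_id.
by rewrite expg1n perm1.
Qed.

(* [u * adj i * w] is [u * w] multiplied by a conjugate of [adj i]. *)
Lemma ncycles_insert_adj i u w :
  (ncycles (u * w) <= (ncycles (u * adj i * w)).+1)%N.
Proof.
have -> : u * adj i * w = adj i ^ u^-1 * (u * w).
  by rewrite conjgE invgK !mulgA mulgKV.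
rewrite tpermJ; set x := u^-1 _; set y := u^-1 _.
have xy : x != y by rewrite (inj_eq perm_inj) -val_eqE /= neq_ltn leqnn.
have /= := porbits_mul_tperm (u * w) x y; rewrite xy /= -!/(ncycles _).
move: (ncycles (u * w)) (ncycles _) => k l.
by case: (x \notin _) => /=; clear; lia.
Qed.

End Cycles.

(** * The word of the longest element *)

Section Reversal.
Variable n : nat.
Local Open Scope group_scope.

(* Indexing by [nat] lets the filtered products below be widened. *)
Let adjn (k : nat) : 'S_n := if insub k is Some i then adj i else 1.

Let adjnE (k : nat) (x : 'I_n) : (k < n.-1)%N -> adjn k x =
  (if x == k :> nat then k.+1 else if x == k.+1 :> nat then k else x) :> nat.
Proof. by move=> lt_kn; rewrite /adjn insubT adjE. Qed.

Lemma adj_prod_cycle (m : nat) (x : 'I_n) : (m <= n.-1)%N ->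
  (\prod_(i < n.-1 | (i < m)%N) adj i) x =
  (if x == 0 :> nat then m else if (x <= m)%N then x.-1 else x) :> nat.
Proof.
move=> le_mn.
have -> : \prod_(i < n.-1 | (i < m)%N) adj i = \prod_(i < m) adjn i.
  rewrite (big_ord_widen _ adjn le_mn); apply: eq_bigr => i _.
  by rewrite /adjn valK.
elim: m le_mn => [|m IHm] le_mn.
  by rewrite big_ord0 perm1; case: (val x).
rewrite big_ord_recr /= permM adjnE // IHm ?(ltnW le_mn) //.
move: (nat_of_ord x) (ltn_ord x) => y lt_yn.
by case: (eqVneq y 0%N) => y0; case: (leqP y m) => ym;
  repeat case: ifP => ?; lia.
Qed.

Lemma adj_prod_reversal (x : 'I_n) :
  (\prod_(k < n.-1) \prod_(i < n.-1 | (i < n.-1 - k)%N) adj i) x = rev_ord x.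
Proof.
pose c k := \prod_(i < n.-1 | (i < n.-1 - k)%N) adj i.
(* After [m] cycles the points below [m] are in their final places and the others have moved down by
   [m]. The next cycle sends the point [m], now at 0, to [n - 1 - m] and fixes the places above
   that. After [n - 1] cycles the last point is at 0, where it belongs. *)
suff prefix m : (m <= n.-1)%N -> (\prod_(k < m) c k) x =
    (if (x < m)%N then n.-1 - x else x - m)%N :> nat.
  apply: val_inj; rewrite /= prefix //; have := ltn_ord x; case: ifP; lia.
elim: m => [|m IHm] le_mn; first by rewrite big_ord0 perm1 subn0.
rewrite big_ord_recr /= permM adj_prod_cycle ?leq_subr // IHm ?(ltnW le_mn) //.
move: (nat_of_ord x) (ltn_ord x) => y lt_yn.
by case: (ltngtP y m) => ym; repeat case: ifP => ?; lia.
Qed.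

Lemma adj_prod_mul (w : 'S_n) :
  (\prod_(k < n.-1) \prod_(i < n.-1 | (i < n.-1 - k)%N) adj i) * w
  = reversal w.
Proof. by apply/perm.permP => x; rewrite permM adj_prod_reversal permE. Qed.

End Reversal.

(** * Propagation of divisibility along the product *)

Section Divisibility.
Variables (K : fieldType) (charK : [pchar K] =i pred0) (n : nat).
Local Notation q := (ratq K).
Local Notation V := {ffun 'S_n -> (ratfun K)^o}.
Implicit Types (u v w : 'S_n) (f : V).

(** Here [u] is the product in ['S_n] of the letters read so far, which is the inverse of their
    [word_perm]. Thus [n - ncycles (u * w)] is the least number of transpositions leading from that
    element to [w]. *)
Definition vanishes_along u f : Prop :=
  forall w, vanishes (n - ncycles (u * w)%g) (f w).

Lemma vanishes_along_basis : vanishes_along 1%g (delta_perm _ 1%g).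
Proof.
move=> w; rewrite ffunE; case: eqP => [->|_]; last exact: vanishes0.
rewrite mulg1 ncycles1 subnn; exists 1; rewrite mulr1.
by split; first exact: (regular_int K 1).
Qed.

Lemma regular_qp1V : regular_at 1 (q + 1)^-1.
Proof.
rewrite /ratq -(tofrac1 {poly K}) -tofracD; apply: regular_tofracV.
(* At [q = 1] the denominator takes the value 2, which is nonzero in characteristic 0. *)
rewrite hornerD hornerX hornerC -mulr2n.
by have := charK 2; rewrite !inE /= => /negbT.
Qed.

Lemma vanishes_along_E i u f : vanishes_along u f ->
  vanishes_along (u * adj i)%g (reg_act (hecke_E q i) f).
Proof.
move=> uf w; rewrite reg_act_E.
have rN2 : regular_at 1 (- 2 : ratfun K).
  exact: (regular_int K (-2)).
have vsw : vanishes (n - ncycles (u * adj i * w)%g) (f (adj i * w)%g).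
  by rewrite -mulgA; apply: uf.
have vw : vanishes (n - ncycles (u * adj i * w)%g) ((q - 1) * f w).
  (* Inserting [adj i] removes at most one cycle, so the required order grows by at most one, and
     the factor [q - 1] supplies it. *)
  apply: vanishesW (vanishesS (uf w)); have := ncycles_insert_adj i u w; lia.
apply: vanishesM; first exact: regular_qp1V.
case: ifP => _; apply: vanishesD.
- exact: vanishesM.
- rewrite -[X in vanishes _ X]mulN1r; apply: vanishesM vw.
  exact: (regular_int K (-1)).
- by apply: vanishesM vsw; apply: regularM => //; apply: regular_q.
- exact: vw.
Qed.

Lemma vanishes_along_Eprod u f : vanishes_along u f ->
  vanishes_along
    (u * \prod_(k < n.-1) \prod_(i < n.-1 | (i < n.-1 - k)%N) adj i)%g
    (reg_act (hecke_Eprod q n) f).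
Proof.
move: u f; apply: (hecke_Eprod_ind (P := fun v x => forall u f,
  vanishes_along u f -> vanishes_along (u * v)%g (reg_act x f))).
- by move=> u f uf; rewrite mulg1 reg_act1.
- by move=> v1 v2 x y IHx IHy u f uf; rewrite reg_actM mulgA; apply/IHy/IHx.
- by move=> i u f; apply: vanishes_along_E.
Qed.

End Divisibility.

Theorem theorem5p2 (K : fieldType) (charK : [pchar K] =i pred0) (n : nat)
    (red : 'S_n -> seq 'I_n.-1) (red_ok : forall w, reduced_word w (red w))
    (c : 'S_n -> ratfun K)
    (c_def : hecke_Eprod (ratq K) n
             = \sum_(w : 'S_n) c w *: \prod_(i <- red w) hecke_T (ratq K) i)
    (w : 'S_n) :
  exists h : ratfun K,
    regular_at 1 h /\
    c w = (ratq K - 1) ^+ (n - ncycles (reversal w)) * h.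
Proof.
(* From [u = 1] and the basis vector of 1, the accumulated [u] becomes the longest element, and its
   product with [w] is the reversal. *)
have := vanishes_along_Eprod charK (@vanishes_along_basis K n) w.
by rewrite mul1g adj_prod_mul c_def reg_act_expansion.
Qed.
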